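(* Let $F$ be a field, let $A$ be a finite-dimensional central simple $F$-algebra containing a (finite) Galois field extension $K/F$ with abelian Galois group $G=\mathrm{Gal}[K/F]$, let $\Gamma$ be a totally ordered abelian (additive) group and let $\varepsilon:\Gamma\to G$ be a surjective homomorphism. Let $C_A(K)$ be the centralizer of $K$ in $A$ and let $\mathcal{D}=C_A(K)((\Gamma))$ be the associated Mal'cev-Neumann ring. If $C_A(K)$ is a division algebra, then $\mathcal{D}$ is a valued division algebra, for the valuation $v$ with $v(0)=\infty$ and $v(S)=\min\,\mathrm{supp}(S)$ for $S\in\mathcal{D}\setminus\{0\}$, with value group $\Gamma$ and residue field (residue division algebra) $C_A(K)$. Its center is $F((\ker\varepsilon))$, and $\deg\mathcal{D}=\deg A$.
   Context: Construction of the Mal'cev-Neumann ring $C_A(K)((\Gamma))$: by the Skolem-Noether theorem, for each $\sigma\in G$ choose $u_\sigma\in A^\times$ with $x^\sigma=u_\sigma^{-1}xu_\sigma$ for all $x\in K$, with $u_{\mathrm{Id}}=1$. The elements of $C_A(K)((\Gamma))$ are formal series $\sum_{\gamma\in\Gamma}a_\gamma r_\gamma$ in indeterminates $a_\gamma$, with $r_\gamma\in C_A(K)$, whose support $\mathrm{supp}\big(\sum_\gamma a_\gamma r_\gamma\big)=\{\gamma\in\Gamma\mid r_\gamma\ne 0\}$ is well-ordered. Addition is componentwise; multiplication is determined by the rules $r a_\gamma=a_\gamma\,(u_{\varepsilon(\gamma)}^{-1}ru_{\varepsilon(\gamma)})$ for $r\in C_A(K)$, $\gamma\in\Gamma$,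 and $a_\gamma a_\delta=a_{\gamma+\delta}\,u_{\varepsilon(\gamma)\varepsilon(\delta)}^{-1}u_{\varepsilon(\gamma)}u_{\varepsilon(\delta)}$ for $\gamma,\delta\in\Gamma$. This is a well-defined associative ring. For $L\subseteq C_A(K)$ and $\Lambda\subseteq\Gamma$, $L((\Lambda))$ denotes the subset of $C_A(K)((\Gamma))$ of elements $\sum_{\gamma\in\Lambda}a_\gamma r_\gamma$ with $r_\gamma\in L$ for all $\gamma\in\Lambda$. The degree of a central simple algebra is the square root of its dimension over its center. A valuation on a division ring $D$ with values in $\Gamma$ is a map $v:D\to\Gamma\cup\{\infty\}$ with $v(x)=\infty\iff x=0$, $v(x+y)\ge\min\{v(x),v(y)\}$ and $v(xy)=v(x)+v(y)$; its residue division ring is $\{v\ge 0\}/\{v>0\}$. *)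

(* Defs.v *)
From HB Require Import structures.
From mathcomp Require Import all_boot all_order all_algebra all_fingroup all_field.
From mathcomp Require Import finmap mathcomp_extra boolp classical_sets functions.
From mathcomp Require Import cardinality fsbigop wochoice.

Set Implicit Arguments.
Unset Strict Implicit.
Unset Printing Implicit Defensive.

Import Order.TTheory GRing.Theory Num.Theory.

Local Open Scope classical_set_scope.
Local Open Scope quotient_scope.
Local Open Scope ring_scope.

(* Totally ordered abelian groups: MathComp's porderZmodType has no axiom
   relating + and <=. *)
HB.mixin Record POrderedZmodule_isOrdered T of Num.POrderedZmodule T := {
  lez_total : total (<=%R : rel T);
  lezD2l : forall z x y : T, x <= y -> z + x <= z + y }.

#[short(type="orderedZmodType")]
HB.structure Definition OrderedZmodule :=
  { T of Num.POrderedZmodule T & POrderedZmodule_isOrdered T }.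

Section OrderedZmoduleTheory.
Variable Gamma : orderedZmodType.
Implicit Types x y z : Gamma.

Lemma comparablez x y : x >=< y.
Proof. exact: lez_total. Qed.

Lemma ltNgez x y : (x < y) = ~~ (y <= x).
Proof. exact/comparable_ltNge/comparablez. Qed.

Lemma leNgtz x y : (x <= y) = ~~ (y < x).
Proof. exact/comparable_leNgt/comparablez. Qed.

Lemma lezD2lE z x y : (z + x <= z + y) = (x <= y).
Proof.
by apply/idP/idP => [/(lezD2l (- z))|/lezD2l//]; rewrite !addKr.
Qed.

Lemma lezD2rE z x y : (x + z <= y + z) = (x <= y).
Proof. by rewrite ![_ + z]addrC lezD2lE. Qed.

Lemma ltzD2lE z x y : (z + x < z + y) = (x < y).
Proof. by rewrite !ltNgez lezD2lE. Qed.

Lemma ltzD2rE z x y : (x + z < y + z) = (x < y).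
Proof. by rewrite !ltNgez lezD2rE. Qed.

Lemma addz_gt0 x y : 0 < x -> 0 <= y -> 0 < x + y.
Proof. by move=> x0 y0; apply: (lt_le_trans x0); rewrite -[leLHS]addr0 lezD2lE. Qed.

Lemma addz_ge0 x y : 0 <= x -> 0 <= y -> 0 <= x + y.
Proof. by move=> x0 y0; apply: (le_trans x0); rewrite -[leLHS]addr0 lezD2lE. Qed.

Lemma doublez_eq0 x : x + x = 0 -> x = 0.
Proof.
move=> xx; case: (comparable_ltgtP (comparablez x 0)) => // x0.
  by move: (x0); rewrite -(ltzD2lE x) xx addr0 => /(lt_trans x0); rewrite ltxx.
by move: (x0); rewrite -(ltzD2lE x) xx addr0 => /(lt_trans x0); rewrite ltxx.
Qed.

Definition well_ordered (S : {pred Gamma}) := wo_chain (<=%R : rel Gamma) S.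

Lemma well_orderedP (S : {pred Gamma}) :
  well_ordered S <->
  (forall T : set Gamma, (forall x, T x -> x \in S) -> (exists x, T x) ->
   exists2 m, T m & forall x, T x -> m <= x).
Proof.
split=> [wS T TS [x Tx]|H].
  case: (wS (mem T)); first by move=> y; rewrite unfold_in => /set_mem/TS.
    by exists x; apply/mem_set.
  move=> m [[/set_mem Tm lbm] _]; exists m => // y Ty.
  by apply: lbm; apply/mem_set.
apply: antisymmetric_wo_chain => [x y _ _|T TS [x Tx]]; first exact: le_anti.
case: (H [set y | y \in T]) => [y /TS//||m Tm lbm]; first by exists x.
by exists m.
Qed.

Lemma well_ordered_sub (S T : {pred Gamma}) :
  {subset S <= T} -> well_ordered T -> well_ordered S.
Proof.
by move=> ST /well_orderedP wT; apply/well_orderedP => U US; apply: wT => x /US/ST.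
Qed.

Lemma well_ordered0 : well_ordered pred0.
Proof. by apply/well_orderedP => T T0 [x /T0]. Qed.

Lemma well_ordered1 a : well_ordered (pred1 a).
Proof.
apply/well_orderedP => T T1 [x Tx]; exists x => // y Ty.
by rewrite (eqP (T1 _ Tx)) (eqP (T1 _ Ty)).
Qed.

Lemma well_orderedU (S T : {pred Gamma}) :
  well_ordered S -> well_ordered T -> well_ordered [predU S & T].
Proof.
move=> /well_orderedP wS /well_orderedP wT; apply/well_orderedP => U US [x0 Ux0].
have [[a [Ua Sa]]|nS] := EM (exists a, U a /\ a \in S); last first.
  apply: wT; last by exists x0.
  move=> x Ux; have := US _ Ux; rewrite inE => /orP[Sx|//].
  by case: nS; exists x.
have [||m [Um Sm] lbm] := wS [set x | U x /\ x \in S].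
- by move=> x [].
- by exists a.
have [[b [Ub Tb]]|nT] := EM (exists b, U b /\ b \in T); last first.
  exists m => // x Ux; apply: lbm; split=> //.
  have := US _ Ux; rewrite inE => /orP[//|Tx].
  by case: nT; exists x.
have [||n [Un Tn] lbn] := wT [set x | U x /\ x \in T].
- by move=> x [].
- by exists b.
have [mn|nm] := comparable_leP (comparablez m n).
  exists m => // x Ux; have := US _ Ux; rewrite inE => /orP[Sx|Tx].
    by apply: lbm.
  by apply: (le_trans mn); apply: lbn.
exists n => // x Ux; have := US _ Ux; rewrite inE => /orP[Sx|Tx].
  by apply: (le_trans (ltW nm)); apply: lbm.
by apply: lbn.
Qed.

Lemma well_orderedD (S T : {pred Gamma}) : well_ordered S -> well_ordered T ->
  well_ordered [pred x | `[< exists a b, [/\ a \in S, b \in T & x = a + b] >]].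
Proof.
move=> /well_orderedP wS /well_orderedP wT.
pose reps (U : set Gamma) a b := [/\ a \in S, b \in T & U (a + b)].
pose inST (U : set Gamma) := forall x, U x ->
  exists a b, [/\ a \in S, b \in T & x = a + b].
pose hasmin (U : set Gamma) := exists2 m, U m & forall x, U x -> m <= x.
have step U : inST U -> (exists x, U x) -> exists a b, reps U a b /\
    forall a' b', reps U a' b' -> a' + b' < a + b -> b' < b.
  move=> US [x0 Ux0].
  have [||a [b0 [Sa Tb0 Uab0]] lba] := wS [set a | exists b, reps U a b].
  - by move=> a [b []].
  - have [a [b [Sa Tb xE]]] := US _ Ux0; exists a, b.
    by split=> //; rewrite -xE.
  have [||b [_ Tb Uab] lbb] := wT [set b | reps U a b].
  - by move=> b [].
  - by exists b0.
  exists a, b; split=> // a' b' [Sa' Tb' Uab'] lt'.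
  rewrite ltNgez; apply/negP => bb'; move: lt'; rewrite ltNgez => /negP[].
  apply: (@le_trans _ _ (a + b')); first by rewrite lezD2lE.
  by rewrite lezD2rE; apply: lba; exists b'.
have cut U x0 : U x0 ->
    ((exists x, U x /\ x < x0) -> hasmin [set x | U x /\ x < x0]) -> hasmin U.
  move=> Ux0 H; have [/H[c [Uc c0] lbc]|nlt] := EM (exists x, U x /\ x < x0).
    exists c => // x Ux; have [x0x|xx0] := comparable_leP (comparablez x0 x); last exact: lbc.
    exact: (le_trans (ltW c0)).
  exists x0 => // x Ux; rewrite leNgtz; apply/negP => lt.
  by apply: nlt; exists x.
pose bounded t := forall U, inST U -> (exists x, U x) ->
    (forall a b, reps U a b -> b < t) -> hasmin U.
have below U x0 t : inST U -> bounded t ->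
    (forall a b, reps U a b -> a + b < x0 -> b < t) ->
    (exists x, U x /\ x < x0) -> hasmin [set x | U x /\ x < x0].
  move=> US bt lt ne; apply: bt => //; first by move=> x [Ux _]; apply: US.
  by move=> a b [Sa Tb [Uab ltx0]]; apply: lt ltx0.
have main t : t \in T -> bounded t.
  move=> Tt; apply: contrapT => nt.
  have [||m [Tm nm] lbm] := wT [set t | t \in T /\ ~ bounded t].
  - by move=> x [].
  - by exists t.
  apply: nm => U US Une Ult.
  have [a [b [abU Hab]]] := step _ US Une; have [Sa Tb Uab] := abU.
  apply: (cut _ (a + b)) => //; apply: (below _ _ b) => //.
  apply: contrapT => nb; have := Ult _ _ abU.
  by rewrite ltNgez lbm.
apply/well_orderedP => U US' Une.
have US : inST U by move=> x /US' /asboolP.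
have [a [b [[Sa Tb Uab] Hab]]] := step _ US Une.
apply: (cut _ (a + b)) => //; apply: (below _ _ b) => //; exact: main.
Qed.

Lemma well_ordered_fibre (S T : {pred Gamma}) h :
  well_ordered S -> well_ordered T ->
  finite_set [set a | a \in S /\ h - a \in T].
Proof.
move=> /well_orderedP wS /well_orderedP wT.
set X := [set a | _].
have minX (Y : set Gamma) : Y `<=` X -> (exists x, Y x) ->
    exists2 m, Y m & forall x, Y x -> m <= x.
  by move=> YX; apply: wS => x /YX[].
have maxX (Y : set Gamma) : Y `<=` X -> (exists x, Y x) ->
    exists2 m, Y m & forall x, Y x -> x <= m.
  move=> YX [x0 Yx0].
  have [||m Ym lbm] := wT [set b | Y (h - b)].
  - by move=> b /YX[]; rewrite subKr.
  - by exists (h - x0); rewrite /= subKr.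
  exists (h - m) => // x Yx.
  have : m <= h - x by apply: lbm; rewrite /= subKr.
  by rewrite -(lezD2rE (x - m)) addrCA subrr addr0 addrA subrK.
apply: contrapT => infX.
have infne Y : ~ finite_set Y -> exists x : Gamma, Y x.
  by move=> nY; apply: contrapT => ne; apply: nY;
    rewrite (_ : Y = set0)// -subset0 => x Yx; apply: ne; exists x.
have [//||M XM ubM] := maxX X; first exact: infne.
pose low y := [set x | X x /\ x <= y].
have [||y [Xy infy] lby] := minX [set y | X y /\ ~ finite_set (low y)].
- by move=> y [].
- exists M; split=> //; rewrite (_ : low M = X)//.
  by apply/seteqP; split=> [x []//|x Xx]; split=> //; apply: ubM.
have infy' : ~ finite_set (low y `\ y).
  move=> fin; apply: infy; apply: (@sub_finite_set _ _ (low y `\ y `|` [set y])).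
    by move=> x Lx; have [->|xy] := eqVneq x y; [right|left; split=> //; apply/eqP].
  by rewrite finite_setU.
have [||m [[Xm my] mney] ubm] := maxX (low y `\ y).
- by move=> x [[]].
- exact: infne.
have : y <= m.
  apply: lby; split=> // fin; apply: infy'; apply: sub_finite_set fin.
  by move=> x Lx; split; [case: Lx => [[]]|apply: ubm].
by move=> ym; apply: mney; apply/eqP; rewrite eq_le my ym.
Qed.

End OrderedZmoduleTheory.

Section Convolution.
Variables (Gamma : orderedZmodType) (R : nzRingType).
Implicit Types f g k : Gamma -> R.

Definition supp f : {pred Gamma} := [pred x | f x != 0].

Lemma fsum_mulr (c : R) (P : set Gamma) f : finite_set P ->
  c * (\sum_(i \in P) f i) = \sum_(i \in P) c * f i.
Proof. by move=> fP; rewrite !fsbig_finite//= mulr_sumr. Qed.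

Lemma fsum_mull (c : R) (P : set Gamma) f : finite_set P ->
  (\sum_(i \in P) f i) * c = \sum_(i \in P) f i * c.
Proof. by move=> fP; rewrite !fsbig_finite//= mulr_suml. Qed.

Lemma fsumT (P : set Gamma) f : (forall x, f x != 0 -> P x) ->
  \sum_(i \in [set: Gamma]) f i = \sum_(i \in P) f i.
Proof.
move=> Pf; apply/esym/fsbig_widen => // x [_ nPx] /=.
by apply/eqP; apply/negPn/negP => /Pf.
Qed.

Lemma fsumN0 f : \sum_(i \in [set: Gamma]) f i != 0 -> exists x, f x != 0.
Proof.
apply: contra_neqP => /forallNP f0; apply: fsbig1 => x _.
by apply/eqP; apply/negPn/negP => /f0.
Qed.

Definition conv f g h := \sum_(a \in [set: Gamma]) f a * g (h - a).

Definition cfib f g h := [set a | a \in supp f /\ h - a \in supp g].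

Lemma cfib_fin f g h : well_ordered (supp f) -> well_ordered (supp g) ->
  finite_set (cfib f g h).
Proof. exact: well_ordered_fibre. Qed.

Lemma cfibP f g h x : f x * g (h - x) != 0 -> cfib f g h x.
Proof.
move=> fg; split; rewrite inE; apply/eqP => z; move/eqP: fg; apply;
by rewrite z ?mul0r ?mulr0.
Qed.

Lemma conv_fib f g h : conv f g h = \sum_(a \in cfib f g h) f a * g (h - a).
Proof. by apply: fsumT => x; apply: cfibP. Qed.

Lemma supp_conv f g h : conv f g h != 0 ->
  exists a b, [/\ a \in supp f, b \in supp g & h = a + b].
Proof.
move=> /fsumN0[a /cfibP[fa ga]]; exists a, (h - a); split=> //.
by rewrite addrC subrK.
Qed.

Lemma convE f g h (P : set Gamma) : finite_set P -> cfib f g h `<=` P ->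
  conv f g h = \sum_(a <- fset_set P) f a * g (h - a).
Proof.
move=> fP sP; rewrite /conv (fsumT (P := P)); first by rewrite fsbig_finite.
by move=> x /cfibP/sP.
Qed.

Lemma convDl f1 f2 g h : well_ordered (supp f1) -> well_ordered (supp f2) ->
  well_ordered (supp g) ->
  conv (fun a => f1 a + f2 a) g h = conv f1 g h + conv f2 g h.
Proof.
move=> w1 w2 wg.
pose P := cfib f1 g h `|` cfib f2 g h.
have fP : finite_set P by rewrite finite_setU; split; apply: cfib_fin.
rewrite !(@convE _ _ _ P fP); first by rewrite -big_split; apply: eq_bigr => x _; rewrite mulrDl.
- by move=> x; right.
- by move=> x; left.
move=> x [f12 gx]; have [f1x|f1x] := eqVneq (f1 x) 0.
  by right; split=> //; move: f12; rewrite !inE f1x add0r.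
by left.
Qed.

Lemma convDr f g1 g2 h : well_ordered (supp f) -> well_ordered (supp g1) ->
  well_ordered (supp g2) ->
  conv f (fun a => g1 a + g2 a) h = conv f g1 h + conv f g2 h.
Proof.
move=> wf w1 w2.
pose P := cfib f g1 h `|` cfib f g2 h.
have fP : finite_set P by rewrite finite_setU; split; apply: cfib_fin.
rewrite !(@convE _ _ _ P fP); first by rewrite -big_split; apply: eq_bigr => x _; rewrite mulrDr.
- by move=> x; right.
- by move=> x; left.
move=> x [fx g12]; have [g1x|g1x] := eqVneq (g1 (h - x)) 0.
  by right; split=> //; move: g12; rewrite !inE g1x add0r.
by left.
Qed.

Lemma convA f g k h : well_ordered (supp f) -> well_ordered (supp g) ->
  well_ordered (supp k) -> conv f (conv g k) h = conv (conv f g) k h.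
Proof.
move=> wf wg wk.
have wfg : well_ordered (supp (conv f g)).
  apply: (well_ordered_sub _ (well_orderedD wf wg)) => x /supp_conv H.
  exact/asboolP.
pose B := [set b | `[< exists x y, [/\ x \in supp f, y \in supp g & b = x + y] >]
                   /\ h - b \in supp k].
have finB : finite_set B.
  exact: (@well_ordered_fibre _ _ _ h (well_orderedD wf wg) wk).
pose A := \bigcup_(b in B) cfib f g b.
have finA : finite_set A by apply: bigcup_finite => // b _; apply: cfib_fin.
have ABP a b : f a * (g (b - a) * k (h - b)) != 0 -> A a /\ B b.
  move=> nz.
  have fa : f a != 0 by apply: contraNneq nz => ->; rewrite mul0r.
  have ga : g (b - a) != 0 by apply: contraNneq nz => ->; rewrite mul0r mulr0.
  have kb : k (h - b) != 0 by apply: contraNneq nz => ->; rewrite !mulr0.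
  have Bb : B b.
    split=> //; apply/asboolP; exists a, (b - a); split=> //.
    by rewrite addrC subrK.
  by split=> //; exists b.
have -> : conv (conv f g) k h =
    \sum_(b \in B) \sum_(a \in A) f a * (g (b - a) * k (h - b)).
  rewrite /conv (fsumT (P := B)); last first.
    move=> b nz.
    have cb : conv f g b != 0 by apply: contraNneq nz; rewrite /conv => ->; rewrite mul0r.
    split; first by apply/asboolP; apply: supp_conv.
    by rewrite inE; apply: contraNneq nz => ->; rewrite mulr0.
  apply: eq_fsbigr => b /set_mem Bb.
  rewrite (fsumT (P := A)); last first.
    by move=> a /cfibP fa; exists b.
  by rewrite fsum_mull//; apply: eq_fsbigr => a _; rewrite mulrA.
rewrite exchange_fsbig// /conv (fsumT (P := A)); last first.
  move=> a nz.
  have fa : f a != 0 by apply: contraNneq nz => ->; rewrite mul0r.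
  have : conv g k (h - a) != 0 by apply: contraNneq nz; rewrite /conv => ->; rewrite mulr0.
  move=> /supp_conv[c [d [gc kd hE]]].
  have hb : h - (c + a) = d by rewrite opprD addrCA hE addrA addNr add0r.
  exists (c + a); last by split=> //; rewrite addrK.
  split; last by rewrite hb.
  by apply/asboolP; exists a, c; split=> //; rewrite addrC.
apply: eq_fsbigr => a _.
rewrite (reindex_fsbigT (fun b => b - a)); last first.
  by exists (fun b => b + a) => x; rewrite ?addrK ?subrK.
have [fa|fa] := eqVneq (f a) 0.
  by rewrite fa mul0r fsbig1// => b _; rewrite mul0r.
have [fin0|] := EM (finite_set [set b | g (b - a) * k (h - b) != 0]); last first.
  move=> nfin; exfalso; apply: nfin.
  apply: (sub_finite_set _ (finite_image (fun c => c + a) (cfib_fin (h - a) wg wk))).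
  move=> b nz; exists (b - a); last by rewrite subrK.
  by apply: cfibP; rewrite opprB addrA subrK.
have -> : \sum_(i \in [set: Gamma]) g (i - a) * k (h - a - (i - a)) =
   \sum_(b \in [set b | g (b - a) * k (h - b) != 0]) g (b - a) * k (h - b).
  rewrite (fsumT (P := [set b | g (b - a) * k (h - b) != 0])).
    by apply: eq_fsbigr => b _; rewrite opprB addrA subrK.
  by move=> b; rewrite opprB addrA subrK.
rewrite fsum_mulr//.
transitivity (\sum_(b \in [set: Gamma]) f a * (g (b - a) * k (h - b))).
  apply/esym/fsumT => b; apply: contraNneq => ->; by rewrite mulr0.
by apply: fsumT => b /ABP[].
Qed.

End Convolution.

Section MalcevNeumann.
Variables (F : fieldType) (A : falgType F) (L : splittingFieldType F).
Variables (iota : 'AHom(L, A)) (Gamma : orderedZmodType).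

(* C_A(K), where K is the image of iota *)
Definition field_cent : {aspace A} := 'C((iota @: fullv)%VS)%AS.

(* [coef g] is the coefficient r_g of the formal series sum_g a_g r_g. *)
Record mn_series := MNSeries {
  coef :> Gamma -> A;
  coef_cent : forall g, coef g \in field_cent;
  coef_wo : well_ordered (supp coef) }.

Lemma mn_eqP (S T : mn_series) : (forall g, S g = T g) -> S = T.
Proof.
case: S T => [s sC sW] [t tC tW] /= /funext E; case: _ / E in tC tW *.
by congr MNSeries; apply: Prop_irrelevance.
Qed.

HB.instance Definition _ := gen_eqMixin mn_series.
HB.instance Definition _ := gen_choiceMixin mn_series.

Fact mn0_wo : well_ordered (supp (fun _ : Gamma => 0 : A)).
Proof. by apply: (well_ordered_sub _ (@well_ordered0 Gamma)) => x; rewrite !inE eqxx. Qed.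
Definition mn0 := MNSeries (fun _ => rpred0 field_cent) mn0_wo.

Fact mnN_cent (S : mn_series) g : - S g \in field_cent.
Proof. by rewrite rpredN coef_cent. Qed.
Fact mnN_wo (S : mn_series) : well_ordered (supp (fun g => - S g)).
Proof. by apply: (well_ordered_sub _ (@coef_wo S)) => x; rewrite !inE oppr_eq0. Qed.
Definition mnN S := MNSeries (mnN_cent S) (@mnN_wo S).

Fact mnD_cent (S T : mn_series) g : S g + T g \in field_cent.
Proof. by rewrite rpredD ?coef_cent. Qed.
Fact mnD_wo (S T : mn_series) : well_ordered (supp (fun g => S g + T g)).
Proof.
apply: (well_ordered_sub _ (well_orderedU (@coef_wo S) (@coef_wo T))) => x.
by rewrite !inE -negb_and; apply: contra => /andP[/eqP-> /eqP->]; rewrite addr0.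
Qed.
Definition mnD S T := MNSeries (mnD_cent S T) (@mnD_wo S T).

Fact mnDA : associative mnD.
Proof. by move=> S T U; apply: mn_eqP => g /=; rewrite addrA. Qed.
Fact mnDC : commutative mnD.
Proof. by move=> S T; apply: mn_eqP => g /=; rewrite addrC. Qed.
Fact mn0D : left_id mn0 mnD.
Proof. by move=> S; apply: mn_eqP => g /=; rewrite add0r. Qed.
Fact mnND : left_inverse mn0 mnN mnD.
Proof. by move=> S; apply: mn_eqP => g /=; rewrite addNr. Qed.

HB.instance Definition _ := GRing.isZmodule.Build mn_series mnDA mnDC mn0D mnND.

Fact mn_mono_cent (g : Gamma) (r : subvs_of field_cent) h :
  (if h == g then vsval r else 0) \in field_cent.
Proof. by case: eqP => _; rewrite ?subvsP ?rpred0. Qed.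
Fact mn_mono_wo (g : Gamma) (r : subvs_of field_cent) :
  well_ordered (supp (fun h => if h == g then vsval r else 0)).
Proof.
apply: (well_ordered_sub _ (@well_ordered1 Gamma g)) => h.
by rewrite !inE; case: (h == g); rewrite ?eqxx.
Qed.
(* the monomial a_g r *)
Definition mn_mono g r := MNSeries (mn_mono_cent g r) (@mn_mono_wo g r).

Variables (eps : Gamma -> gal_of {:L}) (u : gal_of {:L} -> A).

(* r a_g = a_g (twist (eps g) r) *)
Definition twist s (r : A) := (u s)^-1 * r * u s.
(* a_g a_h = a_(g + h) (cocycle (eps g) (eps h)) *)
Definition cocycle s t := (u (s * t)%g)^-1 * u s * u t.

(* (a_g r) (a_h s) = a_(g + h) (cocycle (eps g) (eps h) * twist (eps h) r * s) *)
Definition mn_mul_coef (S T : Gamma -> A) (n : Gamma) : A :=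
  \sum_(g \in [set: Gamma])
     cocycle (eps g) (eps (n - g)) * twist (eps (n - g)) (S g) * T (n - g).

Hypothesis epsD : forall g h, eps (g + h) = (eps g * eps h)%g.
Hypothesis uU : forall s, u s \is a GRing.unit.
Hypothesis uK : forall (s : gal_of {:L}) x, iota (s x) = (u s)^-1 * iota x * u s.
Hypothesis u1 : u 1%g = 1.

Lemma eps0 : eps 0 = 1%g.
Proof. by apply: (mulgI (eps 0)); rewrite -epsD addr0 mulg1. Qed.

Lemma mem_cent (r : A) :
  reflect (forall x, r * iota x = iota x * r) (r \in field_cent).
Proof.
apply: (iffP centvP) => [H x|H _ /memv_imgP[x _ ->]]; last exact: H.
by apply: H; rewrite memv_img ?memvf.
Qed.

Lemma field_centM (r s : A) : r \in field_cent -> s \in field_cent -> r * s \in field_cent.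
Proof. by move=> rC sC; rewrite memvM. Qed.

Lemma iotaJ s x : iota x * u s = u s * iota (s x).
Proof. by rewrite uK !mulrA mulrV ?mul1r. Qed.

Lemma iotaJV s x : (u s)^-1 * iota x = iota (s x) * (u s)^-1.
Proof. by rewrite uK mulrK. Qed.

Lemma twist_cent s r : r \in field_cent -> twist s r \in field_cent.
Proof.
move=> /mem_cent rC; apply/mem_cent => x; rewrite /twist.
have xE : x = s ((s^-1)%g x) by rewrite -galM ?memvf// mulVg gal_id.
rewrite {1 2}xE; set y := (s^-1)%g x.
by rewrite -!mulrA -iotaJ (mulrA r) rC !mulrA iotaJV.
Qed.

Lemma cocycle_cent s t : cocycle s t \in field_cent.
Proof.
apply/mem_cent => x; rewrite /cocycle.
have [y xE] : exists y, x = t (s y).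
  by exists ((s * t)^-1%g x); rewrite -galM ?memvf// -galM ?memvf// mulVg gal_id.
rewrite xE -!mulrA -iotaJ (mulrA (u s)) -iotaJ !mulrA iotaJV galM ?memvf//.
Qed.

Let phi (S : Gamma -> A) g := u (eps g) * S g.

Lemma mn_mulE S T n : mn_mul_coef S T n = (u (eps n))^-1 * conv (phi S) (phi T) n.
Proof.
have E g : cocycle (eps g) (eps (n - g)) * twist (eps (n - g)) (S g) * T (n - g)
   = (u (eps n))^-1 * (phi S g * phi T (n - g)).
  rewrite /cocycle /twist /phi -epsD addrC subrK -!mulrA; congr (_ * (_ * _)).
  by rewrite mulrA mulrV ?mul1r.
rewrite /mn_mul_coef /conv; under eq_fsbigr do rewrite E.
have [fin|inf] := EM (finite_set [set g | phi S g * phi T (n - g) != 0]).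
  rewrite [in RHS](fsumT (P := [set g | phi S g * phi T (n - g) != 0]))//.
  rewrite fsum_mulr//; apply: fsumT => x.
  by apply: contraNneq => ->; rewrite mulr0.
rewrite [in RHS]fsbig_dflt ?mulr0 ?fsbig_dflt//.
  move=> fin; apply: inf; apply: sub_finite_set fin => g nz; split=> //= z.
  by move/eqP: nz; apply; rewrite -[LHS](mulVKr (uU (eps n))) /= z mulr0.
move=> fin; apply: inf; apply: sub_finite_set fin => g nz; split=> //= z.
by move/eqP: nz.
Qed.

Lemma supp_phi S : supp (phi S) =i supp S.
Proof.
move=> g; rewrite !inE /phi; congr (~~ _); apply/eqP/eqP => [|->]; last by rewrite mulr0.
by move/(congr1 (fun x => (u (eps g))^-1 * x)); rewrite /= mulKr// mulr0.
Qed.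

Lemma phi_wo (S : mn_series) : well_ordered (supp (phi S)).
Proof. by apply: (well_ordered_sub _ (@coef_wo S)) => g; rewrite supp_phi. Qed.

Fact mnM_cent (S T : mn_series) n : mn_mul_coef S T n \in field_cent.
Proof.
rewrite /mn_mul_coef; apply: (@big_ind _ (fun r => r \in field_cent)) => [|r s|g _]; first exact: rpred0.
  exact: rpredD.
by apply: field_centM; [apply: field_centM; [exact: cocycle_cent|apply: twist_cent; exact: coef_cent]|exact: coef_cent].
Qed.

Fact mnM_wo (S T : mn_series) : well_ordered (supp (mn_mul_coef S T)).
Proof.
apply: (well_ordered_sub _ (well_orderedD (@phi_wo S) (@phi_wo T))) => n.
rewrite inE mn_mulE => nz; apply/asboolP; apply: supp_conv.
by apply: contraNneq nz => ->; rewrite mulr0.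
Qed.

Definition mnM S T := MNSeries (mnM_cent S T) (@mnM_wo S T).
Definition mn1 := mn_mono 0 1.

Lemma phi_mnM S T : phi (mnM S T) = conv (phi S) (phi T).
Proof. by apply/funext => n; rewrite /phi /= mn_mulE mulVKr. Qed.

Fact mnMA : associative mnM.
Proof.
move=> S T U; apply: mn_eqP => n /=.
by rewrite !mn_mulE !phi_mnM convA//; apply: phi_wo.
Qed.

Fact one_subE : algid field_cent = 1.
Proof. by apply/eqP; rewrite algid_eq1 centv1. Qed.

Fact mn1M : left_id mn1 mnM.
Proof.
move=> S; apply: mn_eqP => n /=.
rewrite mn_mulE /conv (fsumT (P := [set 0])) ?fsbig_set1; last first.
  move=> x; apply: contraNeq => /eqP/eqP x0.
  by rewrite /phi /= (negPf x0) mulr0 mul0r.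
by rewrite /phi /= eqxx one_subE eps0 u1 !mul1r subr0 mulKr.
Qed.

Fact mnM1 : right_id mn1 mnM.
Proof.
move=> S; apply: mn_eqP => n /=.
rewrite mn_mulE /conv (fsumT (P := [set n])) ?fsbig_set1; last first.
  move=> x; apply: contraNeq => /eqP/eqP xn.
  by rewrite /phi /= subr_eq0 [n == x]eq_sym (negPf xn) !mulr0.
by rewrite /phi /= subrr eqxx one_subE eps0 u1 !mulr1 mulKr.
Qed.

Fact mnMDl : left_distributive mnM mnD.
Proof.
move=> S T U; apply: mn_eqP => n /=; rewrite !mn_mulE -mulrDr; congr (_ * _).
rewrite -convDl; try exact: phi_wo.
by congr conv; apply/funext => g; rewrite /phi mulrDr.
Qed.

Fact mnMDr : right_distributive mnM mnD.
Proof.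
move=> S T U; apply: mn_eqP => n /=; rewrite !mn_mulE -mulrDr; congr (_ * _).
rewrite -convDr; try exact: phi_wo.
by congr conv; apply/funext => g; rewrite /phi mulrDr.
Qed.

Fact mn1_neq0 : mn1 != 0.
Proof.
apply/eqP => /(congr1 (fun S : mn_series => S 0)) /=; rewrite eqxx one_subE.
by move/eqP; rewrite oner_eq0.
Qed.

(* L((Lambda)) *)
Definition mn_sub (E : {pred A}) (Lambda : {pred Gamma}) : set mn_series :=
  [set S : mn_series | forall g,
     (g \in Lambda -> S g \in E) /\ (g \notin Lambda -> S g = 0)].

(* The ring C_A(K)((Gamma)), where x^s is [s x]; (s * t)%g maps x to [t (s x)], so
   this is a right action, as the exponent notation requires.  The ring depends
   on [eps] and [u] through its multiplication; the alias keeps the proofs that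
   this yields a ring. *)
Definition mn_ring (eps_morph : forall g h, eps (g + h) = (eps g * eps h)%g)
  (u_unit : forall s, u s \is a GRing.unit)
  (u_conj : forall (s : gal_of {:L}) x, iota (s x) = (u s)^-1 * iota x * u s)
  (u_one : u 1%g = 1) : Type := mn_series.

End MalcevNeumann.

Section MalcevNeumannRing.
Variables (F : fieldType) (A : falgType F) (L : splittingFieldType F).
Variables (iota : 'AHom(L, A)) (Gamma : orderedZmodType).
Variables (eps : Gamma -> gal_of {:L}) (u : gal_of {:L} -> A).
Hypothesis epsD : forall g h, eps (g + h) = (eps g * eps h)%g.
Hypothesis uU : forall s, u s \is a GRing.unit.
Hypothesis uK : forall (s : gal_of {:L}) x, iota (s x) = (u s)^-1 * iota x * u s.
Hypothesis u1 : u 1%g = 1.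
Local Notation D := (mn_ring epsD uU uK u1).

HB.instance Definition _ := GRing.Zmodule.copy D (mn_series iota Gamma).
HB.instance Definition _ := GRing.Zmodule_isNzRing.Build D
  (mnMA epsD uU uK) (mn1M epsD uU uK u1) (mnM1 epsD uU uK u1)
  (mnMDl epsD uU uK) (mnMDr epsD uU uK) (mn1_neq0 iota Gamma).

(* [eps 0 = 1] and [u 1 = 1], so the rules given at [twist] and [cocycle] are the
   instances g = 0, s = 1 and r = s = 1. *)
Lemma mn_monoM g h (r s : subvs_of (field_cent iota)) n :
  ((mn_mono g r : D) * (mn_mono h s : D) : mn_series iota Gamma) n =
  if n == g + h then cocycle u (eps g) (eps h) * twist u (eps h) (vsval r) * vsval s
  else 0.
Proof.
rewrite -[LHS]/(mn_mul_coef eps u (mn_mono g r) (mn_mono h s) n) /mn_mul_coef.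
rewrite (fsumT (P := [set g])) ?fsbig_set1 /=; last first.
  move=> x; apply: contraNeq => /eqP/eqP xg.
  by rewrite (negPf xg) /twist mulr0 mul0r mulr0 mul0r.
rewrite eqxx subr_eq [h + g]addrC; case: eqP => [->|_]; last by rewrite mulr0.
by rewrite [g + h]addrC addrK.
Qed.

End MalcevNeumannRing.

(* Two-sided ideals of a unital algebra are subspaces. *)
Definition central_simple (F : fieldType) (A : falgType F) :=
  'Z({:A})%VS = 1%VS /\
  forall I : {vspace A}, (fullv * I <= I)%VS -> (I * fullv <= I)%VS ->
    I = 0%VS \/ I = fullv.

Definition is_division_ring (R : nzRingType) :=
  forall x : R, x != 0 -> exists2 y, y * x = 1 & x * y = 1.

Definition ring_center (R : nzRingType) : set R :=
  [set z | forall x, z * x = x * z].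

Definition has_center_dim (R : nzRingType) (n : nat) :=
  exists e : 'I_n -> R, forall x, exists! c : {ffun 'I_n -> R},
    (forall i, ring_center (c i)) /\ x = \sum_i c i * e i.

(* The square root is taken in algC: that the dimension is a square is not part
   of the definition. *)
Definition has_degree (R : nzRingType) (d : algC) :=
  exists2 n, has_center_dim R n & d = sqrtC n%:R.

Section Valuation.
Variable Gamma : orderedZmodType.
Implicit Types a b c : option Gamma.

(* In [option Gamma], [None] is the element oo added to Gamma. *)
Definition vle a b : bool :=
  if b is Some y then (if a is Some x then x <= y else false) else true.
Definition vlt a b : bool := ~~ vle b a.
Definition vmin a b := if vle a b then a else b.
Definition vadd a b :=
  if a is Some x then (if b is Some y then Some (x + y) else None) else None.

Record valuation (R : nzRingType) := Valuation {
  val_fun :> R -> option Gamma;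
  val_eqoo : forall x, val_fun x = None <-> x = 0;
  valD : forall x y, vle (vmin (val_fun x) (val_fun y)) (val_fun (x + y));
  valM : forall x y, val_fun (x * y) = vadd (val_fun x) (val_fun y) }.

Lemma vle_trans b a c : vle a b -> vle b c -> vle a c.
Proof. by case: a b c => [a|] [b|] [c|] //=; apply: le_trans. Qed.

Lemma vlt_le a b : vlt a b -> vle a b.
Proof. by case: a b => [a|] [b|] //=; rewrite /vlt /= -ltNgez => /ltW. Qed.

Lemma vlt_le_trans b a c : vlt a b -> vle b c -> vlt a c.
Proof.
rewrite /vlt => ab bc; apply: contra ab => ca; exact: vle_trans ca.
Qed.

Lemma vle_min a b c : vle a b -> vle a c -> vle a (vmin b c).
Proof. by rewrite /vmin; case: ifP. Qed.

Lemma vlt_min a b c : vlt a b -> vlt a c -> vlt a (vmin b c).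
Proof. by rewrite /vmin; case: ifP. Qed.

Variables (R : nzRingType) (v : valuation R).

Lemma val0 : v 0 = None.
Proof. exact/val_eqoo. Qed.

Lemma val1 : v 1 = Some 0.
Proof.
case E : (v 1) => [x|]; last by move/val_eqoo/eqP: E; rewrite oner_eq0.
have := valM v 1 1; rewrite mulr1 E /= => -[xx].
by rewrite -[x](addrK x) -xx subrr.
Qed.

Lemma valN x : v (- x) = v x.
Proof.
have v1 : v (-1) = Some 0.
  case E : (v (-1)) => [y|].
    have := valM v (-1) (-1); rewrite mulrNN mulr1 val1 E /= => -[yy].
    by rewrite (doublez_eq0 (esym yy)).
  by move/val_eqoo/eqP: E; rewrite oppr_eq0 oner_eq0.
by rewrite -mulN1r valM v1; case: (v x) => [y|] //=; rewrite add0r.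
Qed.

Definition vring : {pred R} := [pred x | vle (Some 0) (v x)].

Fact vring_subring : subring_closed vring.
Proof.
split=> [|x y|x y]; rewrite !unfold_in /=; first by rewrite val1 /= lexx.
  by move=> vx vy; apply: vle_trans (valD v _ _); rewrite valN vle_min.
by rewrite valM; case: (v x) (v y) => [a|] [b|] //=; apply: addz_ge0.
Qed.
HB.instance Definition _ := GRing.isSubringClosed.Build R vring vring_subring.

Definition val_ring := {x : R | x \in vring}.
HB.instance Definition _ := Choice.on val_ring.
HB.instance Definition _ := SubChoice.on val_ring.
HB.instance Definition _ := [SubChoice_isSubNzRing of val_ring by <:].

Definition val_ideal : {pred val_ring} := [pred x | vlt (Some 0) (v (val x))].

Lemma val_idealE x : (x \in val_ideal) = vlt (Some 0) (v (val x)).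
Proof. by []. Qed.

Lemma val_ringP (x : val_ring) : vle (Some 0) (v (val x)).
Proof. exact: (valP x). Qed.

Fact val_ideal_zmod : zmod_closed val_ideal.
Proof.
split=> [|x y]; rewrite !val_idealE; first by rewrite rmorph0 val0.
by move=> vx vy; rewrite rmorphB; apply: vlt_le_trans (valD v _ _); rewrite valN vlt_min.
Qed.
HB.instance Definition _ := GRing.isZmodClosed.Build val_ring val_ideal val_ideal_zmod.

Lemma val_idealMl x y : y \in val_ideal -> x * y \in val_ideal.
Proof.
rewrite !val_idealE rmorphM valM; have := val_ringP x.
case: (v (val x)) (v (val y)) => [a|] [b|] //=; rewrite /vlt /= -!ltNgez.
by move=> a0 b0; rewrite addrC addz_gt0.
Qed.

Lemma val_idealMr x y : x \in val_ideal -> x * y \in val_ideal.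
Proof.
rewrite !val_idealE rmorphM valM; have := val_ringP y.
case: (v (val x)) (v (val y)) => [a|] [b|] //=; rewrite /vlt /= -!ltNgez.
by move=> b0 a0; rewrite addz_gt0.
Qed.

(* The residue ring {v >= 0} / {v > 0}.  MathComp's quotient by an ideal is a
   ring only over a commutative ring, hence the multiplication below. *)
Definition residue := Quotient.quot val_ideal.
HB.instance Definition _ := GRing.Zmodule.on residue.
HB.instance Definition _ := EqQuotient.on residue.

Local Notation qrepr := generic_quotient.repr.

Definition res_class (x : val_ring) : residue := \pi_residue x.

Lemma res_classP x y : reflect (res_class x = res_class y) (x - y \in val_ideal).
Proof. by rewrite Quotient.idealrBE; apply: eqP. Qed.

Lemma res_classK (x : residue) : res_class (qrepr x) = x.
Proof. exact: reprK. Qed.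

Lemma res_classD x y : res_class (x + y) = res_class x + res_class y.
Proof. by rewrite /res_class piE. Qed.

Definition res_mul (x y : residue) : residue := res_class (qrepr x * qrepr y).
Definition res_one : residue := res_class 1.

Lemma res_classM x y : res_class (x * y) = res_mul (res_class x) (res_class y).
Proof.
apply/res_classP; set x' := qrepr _; set y' := qrepr _.
have xx' : x - x' \in val_ideal by apply/res_classP; rewrite res_classK.
have yy' : y - y' \in val_ideal by apply/res_classP; rewrite res_classK.
rewrite -[x * y](subrK (x * y')) -mulrBr -addrA -mulrBl rpredD//.
  exact: val_idealMl.
exact: val_idealMr.
Qed.

Fact res_mulA : associative res_mul.
Proof.
move=> x y z; rewrite -[x]res_classK -[y]res_classK -[z]res_classK.
by rewrite -!res_classM mulrA.
Qed.

Fact res_mul1x : left_id res_one res_mul.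
Proof. by move=> x; rewrite -[x]res_classK -res_classM mul1r. Qed.

Fact res_mulx1 : right_id res_one res_mul.
Proof. by move=> x; rewrite -[x]res_classK -res_classM mulr1. Qed.

Fact res_mulDl : left_distributive res_mul +%R.
Proof.
move=> x y z; rewrite -[x]res_classK -[y]res_classK -[z]res_classK.
by rewrite -res_classD -!res_classM mulrDl res_classD.
Qed.

Fact res_mulDr : right_distributive res_mul +%R.
Proof.
move=> x y z; rewrite -[x]res_classK -[y]res_classK -[z]res_classK.
by rewrite -res_classD -!res_classM mulrDr res_classD.
Qed.

Fact res_one_neq0 : res_one != 0.
Proof.
have -> : 0 = res_class 0 by rewrite /res_class piE.
apply/eqP => /res_classP; rewrite val_idealE subr0 rmorph1 val1.
by rewrite /vlt /= lexx.
Qed.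

HB.instance Definition _ := GRing.Zmodule_isNzRing.Build residue
  res_mulA res_mul1x res_mulx1 res_mulDl res_mulDr res_one_neq0.

End Valuation.

(* Main.v *)
From HB Require Import structures.
Require Import Defs.
From mathcomp Require Import all_boot all_order all_algebra all_fingroup all_field.
From mathcomp Require Import fsbigop.
From mathcomp Require Import boolp classical_sets wochoice.

Set Implicit Arguments.
Unset Strict Implicit.
Unset Printing Implicit Defensive.

Import Order.TTheory GRing.Theory Num.Theory.

Local Open Scope classical_set_scope.
Local Open Scope ring_scope.

(** Write K for the image of [iota] and G for its Galois group. Let A_s be the
    space of the a in A with x a = a s(x) for all x in K; it equals u_s C_A(K).
    These spaces satisfy A_s A_t <= A_(s t), and A is their direct sum, because
    K (x)_F K is a product of copies of K indexed by G: dual bases of K/F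
    ([galois_dual_bases]) give the projections A -> A_s ([homog_projections]).

    Replacing the coefficients r_g of a series by u_(eps g) r_g removes the
    cocycle and the twist: D becomes the set of all maps f : Gamma -> A with
    well-ordered support and f g in A_(eps g), multiplied by plain convolution
    ([hcoef], [hcoefM]). All four claims are read off this description.

    Valuation and residue ring. The nonzero coefficients are units of A because
    C_A(K) is a division algebra, so the lowest coefficient of a product is the
    product of the lowest coefficients; in degree 0, where eps is trivial, the
    coefficients are those of C_A(K).

    Inverses. Given S of valuation g0, call T a solution up to e if S T agrees
    with 1 in all degrees <= g0 + e. Two solutions up to e agree in all degrees
    <= e, so all such partial solutions glue to a single series T, whose support
    is well-ordered since the part of it below any of its elements lies in the
    support of a partial solution. If S T <> 1, a monomial corrects the first error at g0 + e and
    yields a solution up to e; but T agrees with that solution in all degrees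
    <= e, so S T is correct at g0 + e after all.

    Center. A central series commutes with all monomials; as eps is surjective,
    these have all homogeneous elements of A as coefficients, so each coefficient
    f g is in the center F of A. A nonzero scalar lies in A_s only for s = 1.

    Degree. Choose a basis e_i of A over F made of homogeneous elements, e_i of
    degree d_i, and h_i in Gamma with eps h_i = d_i. The monomials e_i in degree
    h_i form a basis of D over its center: for f in D, the i-th coordinate of
    f(g + h_i) vanishes unless g is in the kernel of eps. Hence D
    has over its center the dimension that A has over F. *)

(** * Dual bases of a Galois extension *)

Lemma gal_base (F : fieldType) (L : splittingFieldType F) (s : gal_of {:L}) :
  s \in 'Gal({:L} / 1%AS)%g.
Proof.
rewrite gal_kHom ?sub1v //.
by apply/kAHomP => _ /vlineP[k ->]; rewrite linearZ rmorph1.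
Qed.

(** The tensor sum_i x_i (x) y_i is the separability idempotent of L/F: the first
    property computes its images under the maps a (x) b |-> a s(b), the second
    says that multiplying by z on the left or on the right has the same effect.
    The y_i are read off the inverse of the matrix of the s(x_i), which is
    invertible by the independence of automorphisms. *)
Lemma galois_dual_bases (F : fieldType) (L : splittingFieldType F) :
  galois 1%AS {:L} ->
  exists n (x y : 'I_n -> L),
    (forall s : gal_of {:L}, \sum_i x i * s (y i) = (s == 1%g)%:R) /\
    (forall z, exists c : 'I_n -> 'I_n -> F,
       (forall i, z * x i = \sum_j c i j *: x j) /\
       (forall j, z * y j = \sum_i c i j *: y i)).
Proof.
move=> galL.
have GT : #|'Gal({:L} / 1%AS)%g| = #|{: gal_of {:L}}|.
  by apply: eq_card => s; rewrite inE gal_base.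
have dimL : \dim {:L} = #|{: gal_of {:L}}|.
  by have := galois_dim galL; rewrite GT dimv1 divn1.
pose n := #|{: gal_of {:L}}|.
have [X bX] : exists X : n.-tuple L, basis_of {:L} X.
  by rewrite /n -dimL; exists (vbasis {:L}); exact: vbasisP.
pose x (i : 'I_n) : L := X`_i.
have sumG (f : 'I_n -> L) : \sum_i f i = \sum_(s : gal_of {:L}) f (enum_rank s).
  by apply: reindex; apply: onW_bij; exact: enum_rank_bij.
pose M : 'M[L]_n := \matrix_(s, i) (enum_val s : gal_of {:L}) (x i).
have uM : M \in unitmx.
  rewrite -row_free_unit -kermx_eq0; apply/eqP/row_matrixP => k.
  rewrite row0; set r := row k _.
  have rM : r *m M = 0 by apply/sub_kermxP; rewrite row_sub.
  have c0 : forall s : gal_of {:L}, true -> r 0 (enum_rank s) = 0.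
    apply: gal_independent => a _.
    rewrite (coord_basis bX (memvf a)).
    under eq_bigr => s _ do rewrite linear_sum mulr_sumr.
    rewrite exchange_big big1 //= => i _.
    have := congr1 (fun m : 'rV_n => m 0 i) rM; rewrite !mxE => rMi.
    transitivity (coord X i a *: \sum_j r 0 j * M j i); last by rewrite rMi scaler0.
    rewrite scaler_sumr sumG.
    by apply: eq_bigr => s _; rewrite !mxE enum_rankK linearZ scalerAr.
  by apply/rowP => j; rewrite [RHS]mxE -(enum_valK j) c0.
pose y (i : 'I_n) := invmx M i (enum_rank (1%g : gal_of {:L})).
have xy1 (s : gal_of {:L}) : \sum_i s (x i) * y i = (s == 1%g)%:R.
  have := congr1 (fun m : 'M_n => m (enum_rank s) (enum_rank (1%g : gal_of {:L}))) (mulmxV uM).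
  rewrite !mxE (inj_eq enum_rank_inj) => <-.
  by apply: eq_bigr => i _; rewrite !mxE enum_rankK.
have xy (s t : gal_of {:L}) : \sum_i s (x i) * t (y i) = (s == t)%:R.
  rewrite -(rmorph_nat t) eq_mulgV1 -xy1 rmorph_sum.
  by apply: eq_bigr => i _; rewrite rmorphM /= -galM ?memvf // mulgKV.
pose N : 'M[L]_n := \matrix_(i, t) (enum_val t : gal_of {:L}) (y i).
have MN : M *m N = 1%:M.
  apply/matrixP => s t; rewrite !mxE -(inj_eq enum_val_inj) -xy.
  by apply: eq_bigr => i _; rewrite !mxE.
(* A one-sided inverse of a square matrix is two-sided, which turns
   orthogonality over the indices i into orthogonality over the group. *)
have yx i j : \sum_(s : gal_of {:L}) s (y i) * s (x j) = (i == j)%:R.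
  have := congr1 (fun m : 'M_n => m i j) (mulmx1C MN); rewrite !mxE => <-.
  by rewrite sumG; apply: eq_bigr => s _; rewrite !mxE enum_rankK.
exists n, x, y; split=> [s|z].
  by under eq_bigr do rewrite -(gal_id {:L} (x _)); rewrite xy eq_sym.
pose c i j := coord X j (z * x i).
have zx i : z * x i = \sum_j c i j *: x j by exact: coord_basis bX (memvf _).
exists c; split=> // j.
(* [c i j] is the trace of z x_i y_j. *)
have cE i : (c i j)%:A = \sum_(s : gal_of {:L}) s (y j) * s (z * x i).
  transitivity (\sum_k c i k *: \sum_(s : gal_of {:L}) s (y j) * s (x k)).
    rewrite (bigD1 j) //= yx eqxx big1 ?addr0 // => k kj.
    by rewrite yx eq_sym (negPf kj) scaler0.
  under eq_bigr do rewrite scaler_sumr.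
  rewrite exchange_big; apply: eq_bigr => s _ /=.
  by rewrite zx linear_sum mulr_sumr; apply: eq_bigr => k _; rewrite linearZ scalerAr.
transitivity (\sum_i \sum_(s : gal_of {:L}) s (y j * z) * (s (x i) * y i)); last first.
  apply: eq_bigr => i _; rewrite -[c i j *: _]mul1r -scalerCA cE mulr_suml.
  by apply: eq_bigr => s _; rewrite !rmorphM /= !mulrA.
rewrite exchange_big (bigD1 1%g) //= -mulr_sumr xy1 eqxx mulr1 gal_id.
rewrite big1 ?addr0 ?[z * _]mulrC // => s s1.
by rewrite -mulr_sumr xy1 (negPf s1) mulr0.
Qed.

Lemma exists_basis_subseq (F : fieldType) (V : vectType F) (X : seq V) :
  exists Y : seq V, {subset Y <= X} /\ basis_of <<X>>%VS Y.
Proof.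
elim: X => [|v X [Y [YX /andP[/eqP sY fY]]]].
  by exists [::]; split=> //; rewrite span_nil nil_basis.
have [vX|vX] := boolP (v \in <<X>>%VS).
  exists Y; split=> [w /YX wX|]; first by rewrite inE wX orbT.
  by rewrite /basis_of fY andbT sY span_cons; apply/eqP/esym/addv_idPr; rewrite -memvE.
exists (v :: Y); split=> [w|]; first by rewrite !inE => /orP[->//|/YX->]; rewrite orbT.
by rewrite /basis_of !span_cons sY eqxx free_cons sY vX fY.
Qed.

(** * The grading of the algebra by the Galois group *)

Section HomogeneousElements.
Variables (F : fieldType) (A : falgType F) (L : splittingFieldType F).
Variable iota : 'AHom(L, A).
Implicit Types (s t : gal_of {:L}) (a b : A).

(** The component u_s C_A(K) of A, described without u_s. *)
Definition homog s a := forall x, iota x * a = a * iota (s x).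

Lemma homogM s t a b : homog s a -> homog t b -> homog (s * t)%g (a * b).
Proof.
by move=> ha hb x; rewrite mulrA ha -!mulrA hb galM ?memvf.
Qed.

Lemma homog1_cent a : homog 1%g a <-> a \in field_cent iota.
Proof.
split=> [ha|/mem_cent ha x]; last by rewrite gal_id ha.
by apply/mem_cent => x; have := ha x; rewrite gal_id.
Qed.

Lemma homogV s a : homog s a -> a \is a GRing.unit -> homog s^-1%g a^-1.
Proof.
move=> ha ua x; apply: (mulrI ua); rewrite [RHS]mulrA mulrV // mul1r.
have := ha (s^-1%g x); rewrite -galM ?memvf // mulVg gal_id.
by move/(congr1 ( *%R^~ a^-1)); rewrite -!mulrA => <-; rewrite mulrV ?mulr1.
Qed.

(** Since [a] is a unit, it determines the automorphism x |-> a^-1 x a of K. *)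
Lemma homog_uniq s t a : homog s a -> homog t a -> a \is a GRing.unit -> s = t.
Proof.
move=> hs ht ua; apply/eqP/gal_eqP => x _.
have := ht x; rewrite hs => /(mulrI ua) /eqP.
by rewrite -subr_eq0 -linearB /= fmorph_eq0 subr_eq0 => /eqP.
Qed.

Hypothesis galL : galois 1%AS {:L}.

(** The projection onto A_s is a |-> sum_i x_i a s(y_i) for dual bases x, y. Its
    values are in A_s because multiplication by z can be moved across the tensor
    sum_i x_i (x) y_i. The projections add up to the identity because the sum
    over s replaces s(y_i) by the trace of y_i, a scalar, which can be moved to
    the left of a. *)
Lemma homog_projections : exists P : gal_of {:L} -> 'End(A),
  [/\ forall s a, homog s (P s a), forall a, \sum_s P s a = a &
      forall s t a, homog s a -> P t a = if t == s then a else 0].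
Proof.
have [n [x [y [xy zxy]]]] := galois_dual_bases galL.
pose P s : 'End(A) := (\sum_i (amulr (iota (s (y i))) \o amull (iota (x i))))%VF.
have PE s a : P s a = \sum_i iota (x i) * a * iota (s (y i)).
  by rewrite sum_lfunE; apply: eq_bigr => i _; rewrite comp_lfunE !lfunE.
exists P; split=> [s a z|a|s t a ha].
- rewrite PE mulr_sumr mulr_suml; have [c [zx zy]] := zxy z.
  transitivity (\sum_i \sum_j c i j *: (iota (x j) * a * iota (s (y i)))).
    apply: eq_bigr => i _; rewrite !mulrA -rmorphM /= zx linear_sum !mulr_suml.
    by apply: eq_bigr => j _; rewrite linearZ !scalerAl.
  rewrite exchange_big; apply: eq_bigr => j _ /=.
  rewrite -[RHS]mulrA -!rmorphM /= [y j * z]mulrC zy !linear_sum mulr_sumr.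
  by apply: eq_bigr => i _; rewrite !linearZ -scalerAr.
- have trE i : exists k, \sum_(s : gal_of {:L}) s (y i) = k%:A.
    have /vlineP[k kE] := mem_galTrace galL (memvf (y i)); exists k; rewrite -kE.
    by apply: eq_bigl => s; rewrite gal_base.
  under eq_bigr do rewrite PE.
  rewrite exchange_big /=.
  have E i : \sum_(s : gal_of {:L}) iota (x i) * a * iota (s (y i)) =
     iota (\sum_(s : gal_of {:L}) x i * s (y i)) * a.
    rewrite -!mulr_sumr -linear_sum; have [k ->] := trE i.
    by rewrite -scalerAr mulr1 !linearZ rmorph1 -scalerAr mulr1 scalerAl.
  under eq_bigr do rewrite E.
  rewrite -mulr_suml -linear_sum exchange_big (bigD1 1%g) //= xy eqxx.
  by rewrite big1 ?addr0 ?rmorph1 ?mul1r // => s s1; rewrite xy (negPf s1).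
rewrite PE; under eq_bigr do rewrite ha -mulrA -rmorphM.
rewrite -mulr_sumr -linear_sum /=.
have -> : \sum_i s (x i) * t (y i) = (t == s)%:R.
  rewrite -(rmorph_nat s) eq_mulgV1 -xy rmorph_sum.
  by apply: eq_bigr => i _; rewrite rmorphM /= -galM ?memvf // mulgKV.
by rewrite rmorph_nat; case: (t == s); rewrite ?mulr1 ?mulr0.
Qed.

(** The projections of a basis of A span A and are homogeneous, so a subfamily of
    them is a basis. Projecting the expansion of a homogeneous element onto its
    own degree leaves the element unchanged but removes the other degrees. *)
Lemma homog_basis : exists (e : (\dim {:A}).-tuple A) (d : 'I_(\dim {:A}) -> gal_of {:L}),
  [/\ basis_of {:A} e, forall i, homog (d i) e`_i &
      forall s a i, homog s a -> d i != s -> coord e i a = 0].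
Proof.
have [P [hP sumP PE]] := homog_projections.
pose X := [seq P s a | s <- enum {: gal_of {:L}}, a <- vbasis {:A}].
have [Y [YX bY]] := exists_basis_subseq X.
have XT : <<X>>%VS = {:A}%VS.
  apply/vspaceP => a; rewrite memvf -(sumP a) (coord_vbasis (memvf a)).
  apply: rpred_sum => s _; rewrite linear_sum; apply: rpred_sum => i _.
  rewrite linearZ; apply/rpredZ/memv_span/allpairsP; exists (s, (vbasis {:A})`_i).
  by rewrite mem_enum mem_nth ?size_tuple.
rewrite XT in bY.
have sY : size Y == \dim {:A} by rewrite (size_basis (X := in_tuple Y) bY).
pose e : (\dim {:A}).-tuple A := Tuple sY.
have hd (i : 'I_(\dim {:A})) : exists s, homog s e`_i.
  have /YX/allpairsP[[s a] [_ _ ->]] : e`_i \in Y by rewrite mem_nth // (eqP sY).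
  by exists s; apply: hP.
have [d {}hd] := fin_all_exists hd.
exists e, d; split=> // s a i ha dis.
have := PE s s a ha; rewrite eqxx => Pa.
rewrite -Pa {1}(coord_basis (X := e) bY (memvf a)) linear_sum linear_sum big1 // => j _.
rewrite linearZ linearZ /= (PE (d j)) //; case: eqP => [sj|_]; last by rewrite linear0 mulr0.
rewrite coord_free ?(basis_free bY) //; case: eqP => [ij|_]; last by rewrite mulr0.
by rewrite sj ij eqxx in dis.
Qed.

End HomogeneousElements.

(** * Lowest terms of convolutions *)

Section ConvolutionLeadingTerm.
Variables (Gamma : orderedZmodType) (R : nzRingType).
Implicit Types (f k : Gamma -> R) (a b n : Gamma).

Lemma conv_ge f k a b : (forall x, x < a -> f x = 0) -> (forall x, x < b -> k x = 0) ->
  forall n, n < a + b -> conv f k n = 0.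
Proof.
move=> fa kb n; apply: contraTeq => /supp_conv[x [y [fx ky ->]]].
rewrite -leNgtz; apply: (@le_trans _ _ (a + y)).
  by rewrite lezD2lE leNgtz; apply: contraTN ky => /kb; rewrite inE => ->; rewrite eqxx.
by rewrite lezD2rE leNgtz; apply: contraTN fx => /fa; rewrite inE => ->; rewrite eqxx.
Qed.

Lemma conv_lead f k a b : (forall x, x < a -> f x = 0) -> (forall x, x < b -> k x = 0) ->
  conv f k (a + b) = f a * k b.
Proof.
move=> fa kb; rewrite /conv (fsumT (P := [set a])) ?fsbig_set1; first by rewrite [a + b]addrC addrK.
move=> x; apply: contraNeq => /eqP xa.
have [/fa->|ax|//] := comparable_ltgtP (comparablez x a); first by rewrite mul0r.
rewrite (kb (a + b - x)) ?mulr0 //.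
by rewrite -(ltzD2rE x) subrK addrC ltzD2lE.
Qed.

Lemma conv_gt f k a b : (forall x, x < a -> f x = 0) -> (forall x, x <= b -> k x = 0) ->
  forall n, n <= a + b -> conv f k n = 0.
Proof.
move=> fa kb n; rewrite le_eqVlt => /orP[/eqP->|].
  by rewrite conv_lead ?kb ?mulr0 // => x /ltW/kb.
by apply: conv_ge => // x /ltW/kb.
Qed.

Lemma conv_monor f h c n :
  conv f (fun x => if x == h then c else 0) n = f (n - h) * c.
Proof.
rewrite /conv (fsumT (P := [set n - h])) ?fsbig_set1; first by rewrite subKr eqxx.
move=> x; apply: contraNeq => /eqP xn; rewrite ifN ?mulr0 //.
by apply: contra_notN xn => /eqP <-; rewrite subKr.
Qed.

Lemma conv_monol f h c n :
  conv (fun x => if x == h then c else 0) f n = c * f (n - h).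
Proof.
rewrite /conv (fsumT (P := [set h])) ?fsbig_set1 ?eqxx // => x.
by apply: contraNeq => /eqP/eqP/negPf->; rewrite mul0r.
Qed.

Lemma conv_comm f k n : (forall a b, f a * k b = k b * f a) -> conv f k n = conv k f n.
Proof.
move=> fk; rewrite /conv (reindex_fsbigT (fun a => n - a)); last first.
  by exists (fun a => n - a) => x; rewrite subKr.
by apply: eq_fsbigr => a _; rewrite fk subKr.
Qed.

End ConvolutionLeadingTerm.

(** * Series with homogeneous coefficients *)

Section Series.
Variables (F : fieldType) (A : falgType F) (L : splittingFieldType F).
Variables (iota : 'AHom(L, A)) (Gamma : orderedZmodType).
Variables (eps : Gamma -> gal_of {:L}) (u : gal_of {:L} -> A).
Hypothesis epsD : forall g h, eps (g + h) = (eps g * eps h)%g.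
Hypothesis uU : forall s, u s \is a GRing.unit.
Hypothesis uK : forall (s : gal_of {:L}) x, iota (s x) = (u s)^-1 * iota x * u s.
Hypothesis u1 : u 1%g = 1.
Local Notation D := (mn_ring epsD uU uK u1).
Implicit Types (S T : D) (g h x : Gamma) (a b : A).

Lemma homog_u s : homog iota s (u s).
Proof. by move=> x; rewrite uK !mulrA mulrV ?mul1r. Qed.

(** In terms of these coefficients, in A_(eps g) rather than in C_A(K), the product
    of D is a convolution without cocycle or twist. *)
Definition hcoef S g : A := u (eps g) * coef S g.

Lemma hcoef_eq0 S g : (hcoef S g == 0) = (coef S g == 0).
Proof. by rewrite -[RHS](inj_eq (mulrI (uU (eps g)))) mulr0. Qed.

Lemma hcoef0E S g : coef S g = 0 -> hcoef S g = 0.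
Proof. by move/eqP; rewrite -hcoef_eq0 => /eqP. Qed.

Lemma coef0E S g : hcoef S g = 0 -> coef S g = 0.
Proof. by move/eqP; rewrite hcoef_eq0 => /eqP. Qed.

Lemma hcoef_inj S T : hcoef S =1 hcoef T -> S = T.
Proof. by move=> ST; apply: mn_eqP => g; apply: (mulrI (uU (eps g))); apply: ST. Qed.

Lemma coefB S T g : coef (S - T : D) g = coef S g - coef T g.
Proof. by []. Qed.

Lemma hcoefB S T g : hcoef (S - T) g = hcoef S g - hcoef T g.
Proof. by rewrite /hcoef coefB mulrBr. Qed.

Lemma hcoef_sum (I : finType) (f : I -> D) g : hcoef (\sum_i f i) g = \sum_i hcoef (f i) g.
Proof.
by apply: (big_morph (fun S => hcoef S g)) => [S T|]; rewrite /hcoef ?mulr0 // -mulrDr.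
Qed.

Lemma hcoefM S T : hcoef (S * T) = conv (hcoef S) (hcoef T).
Proof. exact: (phi_mnM epsD uU uK). Qed.

Lemma hcoef_homog S g : homog iota (eps g) (hcoef S g).
Proof.
by rewrite -[eps g]mulg1; apply: homogM (homog_u _) _; apply/homog1_cent/coef_cent.
Qed.

Lemma hcoef_exists (f : Gamma -> A) : (forall g, homog iota (eps g) (f g)) ->
  well_ordered (supp f) -> exists S : D, hcoef S = f.
Proof.
move=> hf wf.
have cf g : (u (eps g))^-1 * f g \in field_cent iota.
  apply/homog1_cent; rewrite -(mulVg (eps g)); apply: homogM => //.
  exact: homogV (homog_u _) (uU _).
have wf' : well_ordered (supp (fun g => (u (eps g))^-1 * f g)).
  apply: well_ordered_sub wf => g; rewrite !inE.
  by apply: contra => /eqP->; rewrite mulr0.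
by exists (MNSeries cf wf'); apply/funext => g; rewrite /hcoef /= mulVKr.
Qed.

Lemma hcoef_mono_exists h a : homog iota (eps h) a ->
  exists S : D, hcoef S = fun g => if g == h then a else 0.
Proof.
move=> ha; apply: hcoef_exists => [g|].
  by case: eqP => [->//|_] x; rewrite mulr0 mul0r.
apply: (well_ordered_sub _ (@well_ordered1 Gamma h)) => g.
by rewrite !inE; case: (g == h); rewrite ?eqxx.
Qed.

Lemma minimum_of_suppP S g : minimum_of <=%R (supp S) g <->
  coef S g != 0 /\ forall x, x < g -> coef S x = 0.
Proof.
split=> [[Sg minS]|[Sg minS]]; split=> // x.
  by apply: contraTeq => Sx; rewrite -leNgtz; apply: minS.
by rewrite inE leNgtz; apply: contraNN => /minS->.
Qed.

Lemma series_min S : S != 0 -> exists g, coef S g != 0 /\ forall x, x < g -> coef S x = 0.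
Proof.
move=> S0; have [g Sg] : exists g, coef S g != 0.
  apply: contrapT => /forallNP nS; case/negP: S0; apply/eqP/mn_eqP => g.
  by apply/eqP; apply: contrapT => /negP; apply: nS.
have /well_orderedP/(_ [set x | coef S x != 0])[//||m Sm minS] := @coef_wo _ _ _ _ _ S.
  by exists g.
exists m; split=> // x; apply: contraTeq => Sx; rewrite -leNgtz; exact: minS.
Qed.


(** * Inverses *)

Hypothesis C_div : is_division_ring (subvs_of (field_cent iota)).

Lemma cent_unit r : r \in field_cent iota -> r != 0 -> r \is a GRing.unit.
Proof.
move=> rC r0; have E1 : vsval (1 : subvs_of (field_cent iota)) = 1 := one_subE iota.
have /C_div[y yr ry] : vsproj (field_cent iota) r != 0.
  by apply: contraNneq r0 => /(congr1 vsval); rewrite vsprojK // linear0 => ->.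
apply/unitrP; exists (vsval y).
by split; [move/(congr1 vsval): yr | move/(congr1 vsval): ry]; rewrite E1 /= vsprojK.
Qed.

Lemma hcoef_unit S g : coef S g != 0 -> hcoef S g \is a GRing.unit.
Proof. by move=> Sg; rewrite unitrMr ?uU ?cent_unit // coef_cent. Qed.

Lemma coefM_ge S T (a b : Gamma) : (forall x, x < a -> coef S x = 0) ->
  (forall x, x < b -> coef T x = 0) -> forall n, n < a + b -> coef (S * T : D) n = 0.
Proof.
move=> Sa Tb n nab; apply: coef0E.
by rewrite hcoefM (conv_ge _ _ nab) // => x => [/Sa|/Tb] /hcoef0E.
Qed.

Lemma coefM_gt S T (a b : Gamma) : (forall x, x < a -> coef S x = 0) ->
  (forall x, x <= b -> coef T x = 0) -> forall n, n <= a + b -> coef (S * T : D) n = 0.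
Proof.
move=> Sa Tb n nab; apply: coef0E.
by rewrite hcoefM (conv_gt _ _ nab) // => x => [/Sa|/Tb] /hcoef0E.
Qed.

Lemma hcoefM_lead S T (a b : Gamma) : (forall x, x < a -> coef S x = 0) ->
  (forall x, x < b -> coef T x = 0) -> hcoef (S * T) (a + b) = hcoef S a * hcoef T b.
Proof.
by move=> Sa Tb; rewrite hcoefM conv_lead // => x => [/Sa|/Tb] /hcoef0E.
Qed.

Lemma coefM_lead_neq0 S T (a b : Gamma) : (forall x, x < a -> coef S x = 0) ->
  (forall x, x < b -> coef T x = 0) -> coef S a != 0 -> coef T b != 0 ->
  coef (S * T : D) (a + b) != 0.
Proof.
move=> Sa Tb Sa0 Tb0; rewrite -hcoef_eq0 hcoefM_lead //.
by rewrite -(mulr0 (hcoef S a)) (inj_eq (mulrI (hcoef_unit Sa0))) hcoef_eq0.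
Qed.

(** The series glued from all approximate inverses solves the equation as far as
    any series does, while a first error could always be corrected. *)
Lemma series_right_inverse S : S != 0 -> exists T, S * T = 1.
Proof.
move=> /series_min[g0 [Sg0 minS]].
pose solves e T := forall x, x <= g0 + e -> coef (S * T - 1 : D) x = 0.
(* If T - T' had lowest degree m <= e, then S * (T - T') would be nonzero in
   degree g0 + m, where both S * T and S * T' agree with 1. *)
have agree e e' T T' : solves e T -> solves e' T' -> e <= e' ->
    forall x, x <= e -> coef T x = coef T' x.
  move=> sT sT' ee' x xe; apply/eqP; rewrite -subr_eq0 -[_ - _]/(coef (T - T' : D) x).
  apply: contrapT => /negP R0.
  have [|m [Rm minR]] := @series_min (T - T').
    by apply: contraNneq R0 => ->.
  have mx : m <= x by rewrite leNgtz; apply: contraNN R0 => /minR->.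
  have me : m <= e := le_trans mx xe.
  have := coefM_lead_neq0 minS minR Sg0 Rm; apply/negP; rewrite negbK.
  have -> : S * (T - T') = (S * T - 1) - (S * T' - 1).
    by rewrite mulrBr opprB addrA subrK.
  by rewrite coefB sT ?sT' ?subrr // lezD2lE // (le_trans me).
pose solvable x a := exists e T, [/\ x <= e, solves e T & a = coef T x].
have /choice[t tP] x : exists a, solvable x a \/ a = 0 /\ forall b, ~ solvable x b.
  have [[a xa]|nx] := EM (exists a, solvable x a); first by exists a; left.
  by exists 0; right; split=> // b xb; apply: nx; exists b.
have tE e T x : solves e T -> x <= e -> t x = coef T x.
  move=> sT xe; case: (tP x) => [[e' [T' [xe' sT' ->]]]|[_ /(_ (coef T x))[]]]; last first.
    by exists e, T.
  have [ee'|/ltW e'e] := comparable_leP (comparablez e e').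
    exact/esym/(agree e e').
  exact: (agree e' e).
have tC x : t x \in field_cent iota.
  case: (tP x) => [[e [T [_ _ ->]]]|[-> _]]; [exact: coef_cent|exact: rpred0].
(* Below any of its elements x, the support of t is that of a single series T. *)
have tW : well_ordered (supp t).
  apply/well_orderedP => U Ut [x Ux].
  have := Ut _ Ux; rewrite inE; case: (tP x) => [[e [T [xe sT _]]] _|[-> _]]; last by rewrite eqxx.
  have /well_orderedP/(_ [set y | U y /\ y <= e])[||m [Um me] minm] := @coef_wo _ _ _ _ _ T.
  - by move=> y [/Ut]; rewrite !inE => ty ye; rewrite -(tE e).
  - by exists x.
  exists m => // y Uy; have [ye|ey] := comparable_leP (comparablez y e); first exact: minm.
  exact: le_trans me (ltW ey).
pose T : D := MNSeries tC tW.
have solT e T0 : solves e T0 -> solves e T.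
  move=> sT0 x xe.
  have -> : S * T - 1 = S * (T - T0) + (S * T0 - 1) by rewrite mulrBr addrA subrK.
  rewrite -[LHS]/(coef (S * (T - T0) : D) x + coef (S * T0 - 1 : D) x) sT0 // addr0.
  apply: coefM_gt xe => // y ye.
  by rewrite coefB /= (tE e T0) ?subrr.
exists T; apply/eqP; rewrite -subr_eq0; apply: contrapT => /negP E0.
have [n [En minE]] := series_min E0.
pose e := n - g0; have nE : n = g0 + e by rewrite addrC subrK.
have uS := hcoef_unit Sg0.
(* The monomial M cancels the error of S * T in degree n. *)
have [|M hM] := @hcoef_mono_exists e ((hcoef S g0)^-1 * hcoef (S * T - 1) n).
  have -> : eps e = ((eps g0)^-1 * eps n)%g by rewrite nE epsD mulKg.
  by apply: homogM (hcoef_homog _ _); apply: homogV uS; apply: hcoef_homog.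
have Me x : x < e -> coef M x = 0.
  by move=> xe; apply: coef0E; rewrite hM lt_eqF.
have : solves e (T - M).
  move=> x; rewrite -nE; have -> : S * (T - M) - 1 = (S * T - 1) - S * M.
    by rewrite mulrBr addrAC.
  rewrite le_eqVlt => /orP[/eqP->|xn].
    by apply: coef0E; rewrite hcoefB {2}nE hcoefM_lead // hM eqxx mulVKr // subrr.
  by rewrite coefB minE // (coefM_ge minS Me) ?subrr // -nE.
move=> /solT/(_ n); rewrite -nE lexx => /(_ isT) E0'.
by rewrite E0' eqxx in En.
Qed.

(** The right inverse T of S has itself a right inverse, which must be S. *)
Lemma series_division : is_division_ring D.
Proof.
move=> S S0; have [T ST] := series_right_inverse S0.
have T0 : T != 0.
  by apply/eqP => T0; have := oner_neq0 D; rewrite -ST T0 mulr0 eqxx.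
have [S' TS'] := series_right_inverse T0.
exists T => //; suff -> : S = S' by [].
by rewrite -[S]mulr1 -TS' mulrA ST mul1r.
Qed.

(** * Valuation and residue ring *)

Definition has_min (S : D) (o : option Gamma) : Prop :=
  if o is Some g then coef S g != 0 /\ forall x, x < g -> coef S x = 0 else S = 0.

Lemma has_min_vle S o g : has_min S o ->
  (vle (Some g) o <-> forall x, x < g -> coef S x = 0).
Proof.
case: o => [m /= [Sm minS]|/= -> //]; split=> [gm x xg|Sg].
  exact/minS/(lt_le_trans xg).
by rewrite leNgtz; apply: contraNN Sm => /Sg->.
Qed.

Lemma has_min_vlt S o g : has_min S o ->
  (vlt (Some g) o <-> forall x, x <= g -> coef S x = 0).
Proof.
case: o => [m /= [Sm minS]|/= -> //]; rewrite /vlt /= -ltNgez; split=> [gm x xg|Sg].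
  exact/minS/(le_lt_trans xg).
by rewrite ltNgez; apply: contraNN Sm => /Sg->.
Qed.

Lemma has_min_uniq S o o' : has_min S o -> has_min S o' -> o = o'.
Proof.
case: o o' => [g|] [g'|] //= [] => [Sg minS [Sg' minS']|Sg _ S0|S0 [Sg _]].
- congr Some; apply: le_anti; rewrite !leNgtz; apply/andP; split.
    by apply: contraNN Sg' => /minS->.
  by apply: contraNN Sg => /minS'->.
- by move: Sg; rewrite S0 eqxx.
by move: Sg; rewrite S0 eqxx.
Qed.

Lemma has_min_mono g : has_min (mn_mono g 1) (Some g).
Proof. by split=> [|x xg]; rewrite /= ?eqxx ?one_subE ?oner_neq0 // lt_eqF. Qed.

(** The value is chosen by [has_min], which determines it uniquely; so the axioms
    are checked by exhibiting lowest coefficients of sums and products. *)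
Lemma series_valuation : exists v : valuation Gamma D, forall S, has_min S (v S).
Proof.
have /choice[v vP] S : exists o, has_min S o.
  have [->|/series_min[g Sg]] := eqVneq S 0; first by exists None.
  by exists (Some g).
have v0 S : v S = None <-> S = 0.
  split=> [vS|->]; first by have := vP S; rewrite vS.
  exact: (has_min_uniq (vP 0)).
have vD S T : vle (vmin (v S) (v T)) (v (S + T)).
  case E : (vmin (v S) (v T)) => [g|].
    have gS : vle (Some g) (v S).
      rewrite -E /vmin; case: ifP; first by case: (v S) => /=.
      case: (v S) (v T) => [a|] [b|] //=; case: (comparable_leP (comparablez a b)) => //.
      by move=> /ltW.
    have gT : vle (Some g) (v T).
      by rewrite -E /vmin; case: ifP => //; case: (v T) => /=.
    apply/(has_min_vle _ (vP _)) => x xg.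
    have /(has_min_vle _ (vP _))/(_ x xg) Sx := gS.
    have /(has_min_vle _ (vP _))/(_ x xg) Tx := gT.
    by rewrite -[LHS]/(coef S x + coef T x) Sx Tx addr0.
  have [/v0-> /v0->] : v S = None /\ v T = None.
    by move: E; rewrite /vmin; case: (v S) (v T) => [a|] [b|] //=; case: ifP.
  by rewrite addr0 (v0 0).2.
have vM S T : v (S * T) = vadd (v S) (v T).
  apply: (has_min_uniq (vP _)); have := vP S; have := vP T.
  case: (v S) (v T) => [a|] [b|] /=.
  - move=> [Tb minT] [Sa minS]; split; first exact: coefM_lead_neq0.
    exact: coefM_ge.
  - by move=> -> _; rewrite mulr0.
  - by move=> _ ->; rewrite mul0r.
  by move=> _ ->; rewrite mul0r.
by exists (Valuation v0 vD vM).
Qed.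

(** In degree 0 the cocycle and the twist are trivial, which makes the coefficient
    a ring morphism on the valuation ring. *)
Lemma coef0M S T : (forall x, x < 0 -> coef S x = 0) -> (forall x, x < 0 -> coef T x = 0) ->
  coef (S * T : D) 0 = coef S 0 * coef T 0.
Proof.
move=> S0 T0; have := hcoefM_lead S0 T0.
by rewrite addr0 /hcoef (eps0 epsD) u1 !mul1r.
Qed.

Lemma residue_series (v : valuation Gamma D) : (forall S, has_min S (v S)) ->
  exists2 phi : {rmorphism residue v -> subvs_of (field_cent iota)}, bijective phi &
    forall S : val_ring v, vsval (phi (res_class S)) = coef (val S) 0.
Proof.
move=> vP; set C := subvs_of _.
have vring_coef (S : val_ring v) x : x < 0 -> coef (val S) x = 0.
  by apply: (has_min_vle _ (vP _)).1; exact: val_ringP.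
pose p (z : residue v) : C := vsproj (field_cent iota) (coef (val (generic_quotient.repr z)) 0).
have pE (S : val_ring v) : vsval (p (res_class S)) = coef (val S) 0.
  rewrite vsprojK ?coef_cent //.
  have /res_classP : res_class (generic_quotient.repr (res_class S)) = res_class S by rewrite res_classK.
  rewrite val_idealE => /(has_min_vlt _ (vP _))/(_ 0 (lexx 0)).
  by rewrite rmorphB coefB => /eqP; rewrite subr_eq0 => /eqP.
have pB : zmod_morphism p.
  move=> z w; rewrite -[z]res_classK -[w]res_classK; apply: subvs_inj.
  have -> : res_class (generic_quotient.repr z) - res_class (generic_quotient.repr w) =
      res_class (generic_quotient.repr z - generic_quotient.repr w).
    by apply/eqP; rewrite subr_eq -res_classD subrK.
  by rewrite [RHS]linearB /= !pE rmorphB.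
have pM : monoid_morphism p.
  split=> [|z w]; first by apply: subvs_inj; rewrite /= -[1]/(res_class 1) pE /= eqxx.
  rewrite -[z]res_classK -[w]res_classK -[_ * _]/(res_mul _ _) -res_classM; apply: subvs_inj => /=.
  by rewrite !pE rmorphM coef0M //; apply: vring_coef.
pose phi : {rmorphism residue v -> C} :=
  HB.pack p (GRing.isZmodMorphism.Build _ _ p pB) (GRing.isMonoidMorphism.Build _ _ p pM).
exists phi => //.
have vm (r : C) : mn_mono 0 r \in vring v.
  apply/(has_min_vle _ (vP _)) => x x0 /=.
  by rewrite lt_eqF.
(* The inverse sends r to the class of the constant series r. *)
pose q (r : C) : residue v := res_class (Sub (mn_mono 0 r : D) (vm r) : val_ring v).
exists q => [z|r]; last by apply: subvs_inj; rewrite /= pE /= eqxx.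
rewrite -[z]res_classK; apply/res_classP; rewrite val_idealE.
apply/(has_min_vlt _ (vP _)) => x; rewrite rmorphB coefB /= pE.
case: eqP => [->|/eqP x0 xle]; first by rewrite subrr.
by rewrite vring_coef ?subrr // lt_neqAle x0.
Qed.

(** * Center and degree *)

Hypothesis galL : galois 1%AS {:L}.
Hypothesis eps_surj : forall s : gal_of {:L}, s \in 'Gal({:L} / 1%AS)%g -> exists g, eps g = s.
Hypothesis A_center : 'Z({:A})%VS = 1%VS.

Lemma mem_center a : a \in 1%VS <-> forall b, a * b = b * a.
Proof.
rewrite -A_center memv_cap memvf; split=> [/centvP aC b|aC]; first exact/aC/memvf.
by apply/centvP => b _.
Qed.

Lemma homog_scalar s (c : F) : homog iota s c%:A -> c != 0 -> s = 1%g.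
Proof.
move=> hc c0; apply: (homog_uniq hc); first by apply/homog1_cent/rpredZ/centv1.
by rewrite scaler_unit ?unitfE // unitr1.
Qed.

(** A monomial with coefficient a in degree h multiplies f to f a or a f, shifted by
    h; by surjectivity of eps, every homogeneous a occurs, so each f(g) commutes
    with all of A. By [homog_scalar] the scalars [c g] vanish where [eps g] is
    nontrivial. *)
Lemma ring_center_series S :
  ring_center S <-> exists c : Gamma -> F, forall g, hcoef S g = (c g)%:A.
Proof.
split=> [Sc|[c Sc] T]; last first.
  apply: hcoef_inj => g; rewrite !hcoefM; apply: conv_comm => a b.
  by rewrite Sc -scalerAl -scalerAr mul1r mulr1.
have hc g : hcoef S g \in 1%VS.
  have [P [hP sumP _]] := homog_projections iota galL.
  apply/mem_center => b; rewrite -(sumP b) mulr_sumr mulr_suml.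
  apply: eq_bigr => s _; have [h hs] := eps_surj (gal_base s).
  have [|T hT] := @hcoef_mono_exists h (P s b); first by rewrite hs.
  have := congr1 (fun U => hcoef U (g + h)) (Sc T); rewrite !hcoefM hT.
  by rewrite conv_monor conv_monol addrK.
have /choice[c cP] g : exists c, hcoef S g = c%:A by apply/vlineP.
by exists c.
Qed.

Lemma center_series :
  @ring_center D = mn_sub (mem (1%VS : {vspace A})) [pred g | eps g == 1%g].
Proof.
apply/seteqP; split=> S.
  move=> /ring_center_series[c cP] g; have cg := cP g; split=> [/eqP g1|g1].
    by move: cg; rewrite /hcoef g1 u1 mul1r => ->; apply: rpredZ; rewrite memv_line.
  apply: coef0E; rewrite cg; have [->|c0] := eqVneq (c g) 0; first by rewrite scale0r.
  case/eqP: g1; apply: (homog_scalar _ c0); rewrite -cg; exact: hcoef_homog.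
move=> Ssub; apply/ring_center_series.
have /choice[c cP] g : exists c, hcoef S g = c%:A; last by exists c.
have [g1 gn1] := Ssub g; apply/vlineP.
have [e1|en1] := eqVneq (eps g) 1%g.
  by rewrite /hcoef e1 u1 mul1r; apply: g1; rewrite inE e1.
by rewrite hcoef0E ?mem0v // gn1 // inE.
Qed.

(** With the homogeneous basis e_i of A, the series f = sum_i c_i E_i has the
    coefficients f(g) = sum_i c_i(g - h_i) e_i. This determines the scalars
    c_i(g) as the i-th coordinates of f(g + h_i); they vanish unless
    eps (g + h_i) = d_i, that is unless eps g = 1, so c_i is central. *)
Lemma center_dim_series : has_center_dim D (\dim {:A}).
Proof.
have [e [d [be hd de]]] := homog_basis iota galL.
(* E i is the monomial with coefficient e_i in a degree h_i above d_i. *)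
have /choice[h hE] i : exists h, eps h = d i by apply/eps_surj/gal_base.
have /choice[E EE] i : exists E : D, hcoef E = fun g => if g == h i then e`_i else 0.
  by apply: hcoef_mono_exists; rewrite hE.
have sumE (c : 'I_(\dim {:A}) -> D) g :
    hcoef (\sum_i c i * E i) g = \sum_i hcoef (c i) (g - h i) * e`_i.
  by rewrite hcoef_sum; apply: eq_bigr => i _; rewrite hcoefM EE conv_monor.
exists E => S.
have /choice[c cP] i : exists c : D, hcoef c = fun g => (coord e i (hcoef S (g + h i)))%:A.
  apply: hcoef_exists => [g|].
    have [k0|k0] := eqVneq (coord e i (hcoef S (g + h i))) 0.
      by move=> x; rewrite k0 scale0r mulr0 mul0r.
    have -> : eps g = 1%g.
      apply: (mulIg (d i)); rewrite mul1g -hE -epsD; apply/eqP.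
      by apply: contraNT k0 => gh; apply/eqP/(de _ _ _ (hcoef_homog S _)); rewrite -hE eq_sym.
    by apply/homog1_cent/rpredZ/centv1.
  have wS := well_orderedD (@coef_wo _ _ _ _ _ S) (@well_ordered1 _ (- h i)).
  apply: (well_ordered_sub _ wS) => g k0; apply/asboolP; exists (g + h i), (- h i).
  split; rewrite ?inE ?addrK // -hcoef_eq0.
  by apply: contraTneq k0 => S0; rewrite inE S0 linear0 scale0r eqxx.
exists [ffun i => c i]; split=> [|c' [c'Z Sc']].
  split=> [i|]; first by rewrite ffunE; apply/ring_center_series; eexists => g; rewrite cP.
  under eq_bigr do rewrite ffunE.
  apply: hcoef_inj => g; rewrite sumE {1}(coord_basis be (memvf (hcoef S g))).
  by apply: eq_bigr => i _; rewrite cP subrK -scalerAl mul1r.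
apply/ffunP => i; rewrite ffunE; apply: hcoef_inj => g; rewrite cP.
have /choice[k kP] j := (ring_center_series (c' j)).1 (c'Z j).
rewrite Sc' sumE; under eq_bigr do rewrite kP -scalerAl mul1r.
by rewrite coord_sum_free ?(basis_free be) // addrK -kP.
Qed.

Lemma center_dim_algebra : has_center_dim A (\dim {:A}).
Proof.
pose e := vbasis {:A}; have be : basis_of {:A} e := vbasisP _.
exists (fun i => e`_i) => a; exists [ffun i => (coord e i a)%:A]; split=> [|c [cZ ac]].
  split=> [i b|]; first by rewrite ffunE -scalerAl -scalerAr mul1r mulr1.
  rewrite {1}(coord_basis be (memvf a)); apply: eq_bigr => i _.
  by rewrite ffunE -scalerAl mul1r.
have /choice[k kP] i : exists k, c i = k%:A by apply/vlineP/mem_center/cZ.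
apply/ffunP => i; rewrite ffunE ac; under eq_bigr do rewrite kP -scalerAl mul1r.
by rewrite coord_sum_free ?(basis_free be).
Qed.

End Series.

(** * The theorem *)

Theorem theorem1p2 (F : fieldType) (A : falgType F)
  (L : splittingFieldType F) (iota : 'AHom(L, A)) (Gamma : orderedZmodType)
  (eps : Gamma -> gal_of {:L}) (u : gal_of {:L} -> A)
  (A_central_simple : central_simple A)
  (L_galois : galois 1%AS {:L}) (L_abelian : abelian 'Gal({:L} / 1%AS))
  (epsD : forall g h, eps (g + h) = (eps g * eps h)%g)
  (eps_surj : forall s : gal_of {:L}, s \in 'Gal({:L} / 1%AS)%g -> exists g, eps g = s)
  (u_unit : forall s, u s \is a GRing.unit)
  (u_conj : forall (s : gal_of {:L}) x, iota (s x) = (u s)^-1 * iota x * u s)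
  (u_one : u 1%g = 1) :
  let C := subvs_of (field_cent iota) in
  let D := mn_ring epsD u_unit u_conj u_one in
  is_division_ring C ->
  [/\ is_division_ring D,
      exists v : valuation Gamma D,
        [/\ v 0 = None,
            forall S : D, S != 0 ->
              exists2 g, v S = Some g & minimum_of <=%R (supp S) g,
            forall g : Gamma, exists2 S : D, S != 0 & v S = Some g
          & exists2 phi : {rmorphism residue v -> C}, bijective phi &
              forall S : val_ring v, vsval (phi (res_class S)) = coef (val S) 0],
      @ring_center D = mn_sub (mem (1%VS : {vspace A})) [pred g | eps g == 1%g]
    & exists2 d : algC, has_degree D d & has_degree A d].
Proof.
move=> C D C_div; have [A_center _] := A_central_simple.
split.
- exact: series_division.
- have [v vP] := series_valuation epsD u_unit u_conj u_one C_div; exists v; split.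
  + exact: val0.
  + move=> S S0; have := vP S; case: (v S) => [g Sg|S00]; last by rewrite S00 eqxx in S0.
    by exists g => //; apply/minimum_of_suppP.
  + move=> g; have min_g := has_min_mono epsD u_unit u_conj u_one g.
    exists (mn_mono g 1); last exact: has_min_uniq (vP _) min_g.
    by case: min_g => Sg _; apply: contraNneq Sg => ->.
  exact: residue_series.
- exact: center_series.
exists (sqrtC (\dim {:A})%:R); exists (\dim {:A}) => //.
  exact: center_dim_series.
exact: center_dim_algebra.
Qed.
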